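(* Let $f_1,\dots,f_n:\mathbb{R}^d\to\mathbb{R}$ be such that each $f_i$ is $L_i$-smooth and $\mu_i$-strongly convex with minimizer $x_i$. Let $\alpha_1,\dots,\alpha_n\in(0,1)$, $T_i(x) = \alpha_i x + (1-\alpha_i)x_i$, $\tilde f(x) = \frac{1}{n}\sum_i f_i(T_i(x))$ with minimizer $x^*$, $L_\alpha = \frac{1}{n}\sum_i\alpha_i^2L_i$ and $\mu_\alpha = \frac{1}{n}\sum_i\alpha_i^2\mu_i$. Let $\omega_1,\dots,\omega_n\ge 0$, and consider distributed compressed gradient descent applied to $\tilde f$: starting from $x^0\in\mathbb{R}^d$, \[ x^{k+1} = x^k - \gamma\,\frac{1}{n}\sum_{i=1}^n \mathcal{C}_i^k\big(\alpha_i\nabla f_i(T_i(x^k))\big), \] where the $\mathcal{C}_i^k\in\mathbb{B}^d(\omega_i)$ are random compression operators drawn independently across $i$ and $k$. If $0<\gamma \leq \left(L_\alpha + \frac{2\max_i\{L_i\alpha_i^2\omega_i\}}{n}\right)^{-1}$, then for all $k\ge0$ \[ \mathbb{E}\|x^k - x^*\|^2 \leq (1-\gamma\mu_\alpha)^k\|x^0 - x^*\|^2 + \frac{2\gamma}{\mu_\alpha n^2}\sum_{i=1}^n\omega_i\|\alpha_i\nabla f_i(T_i(x^* ))\|^2. \]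
   Context: A (random) operator $\mathcal{C}$ belongs to $\mathbb{B}^d(\omega)$ if $\mathbb{E}[\mathcal{C}(x)] = x$ and $\mathbb{E}\|\mathcal{C}(x)-x\|^2\leq\omega\|x\|^2$ for all $x\in\mathbb{R}^d$. A differentiable $g$ is $L$-smooth if $\|\nabla g(x)-\nabla g(y)\|\leq L\|x-y\|$ for all $x,y$, and $\mu$-strongly convex if $g(x)\geq g(y)+\langle\nabla g(y),x-y\rangle+\frac{\mu}{2}\|x-y\|^2$. Note $\alpha_i\nabla f_i(T_i(x))$ is the gradient of $x\mapsto f_i(T_i(x))$. *)

(* Defs.v *)
From HB Require Import structures.
From mathcomp Require Import all_boot all_order all_algebra.
From mathcomp Require Import all_classical all_reals all_analysis.

Set Implicit Arguments.
Unset Strict Implicit.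
Unset Printing Implicit Defensive.

Import Order.TTheory GRing.Theory Num.Theory.
Import numFieldNormedType.Exports.

Local Open Scope classical_set_scope.
Local Open Scope ring_scope.

Section Defs.
Variable R : realType.

Definition dotp (d : nat) (x y : 'rV[R]_d) : R := \sum_(j < d) x 0 j * y 0 j.
Definition sqnorm (d : nat) (x : 'rV[R]_d) : R := dotp x x.
Definition enorm (d : nat) (x : 'rV[R]_d) : R := Num.sqrt (sqnorm x).

Definition is_gradient (d : nat) (f : 'rV[R]_d -> R) (gf : 'rV[R]_d -> 'rV[R]_d) :=
  forall x, differentiable f x /\ forall v, 'd f x v = dotp (gf x) v.

Definition smooth (d : nat) (L : R) (gf : 'rV[R]_d -> 'rV[R]_d) :=
  forall x y, enorm (gf x - gf y) <= L * enorm (x - y).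

Definition strongly_convex (d : nat) (mu : R) (f : 'rV[R]_d -> R)
    (gf : 'rV[R]_d -> 'rV[R]_d) :=
  forall x y, f y + dotp (gf y) (x - y) + mu / 2 * sqnorm (x - y) <= f x.

Definition is_minimizer (d : nat) (f : 'rV[R]_d -> R) (x : 'rV[R]_d) :=
  forall y, f x <= f y.

(** The row vector with coordinates given by a d-tuple (used to give R^d the
    product (Borel) sigma-algebra, which MathComp-Analysis provides on tuples). *)
Definition rv_of_tuple (d : nat) (t : d.-tuple R) : 'rV[R]_d := \row_j tnth t j.

Context {d0 : measure_display} {Omega : measurableType d0}.

Definition in_Bd (d : nat) (P : probability Omega R)
    (C : Omega -> 'rV[R]_d -> 'rV[R]_d) (w : R) :=
  forall x : 'rV[R]_d,
    (forall j : 'I_d, (\int[P]_om ((C om x) 0 j)%:E = (x 0 j)%:E)%E) /\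
    (\int[P]_om (sqnorm (C om x - x))%:E <= (w * sqnorm x)%:E)%E.

Definition mutually_independent {I : eqType} {dS : measure_display}
    {S : measurableType dS} (P : probability Omega R) (X : I -> Omega -> S) :=
  forall (J : seq I) (B : I -> set S), uniq J ->
    (forall j, j \in J -> measurable (B j)) ->
    P (\big[setI/setT]_(j <- J) (X j @^-1` B j)) =
    (\prod_(j <- J) P (X j @^-1` B j))%E.

End Defs.

Definition Tmap {R : realType} (d : nat) (a : R) (xi x : 'rV[R]_d) : 'rV[R]_d :=
  a *: x + (1 - a) *: xi.

Fixpoint dcgd_iter {R : realType} {Omega : Type} (d n : nat)
    (gamma : R) (alpha : 'I_n -> R) (xm : 'I_n -> 'rV[R]_d)
    (gf : 'I_n -> 'rV[R]_d -> 'rV[R]_d)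
    (C : nat -> 'I_n -> Omega -> 'rV[R]_d -> 'rV[R]_d)
    (x0 : 'rV[R]_d) (k : nat) (om : Omega) : 'rV[R]_d :=
  match k with
  | 0 => x0
  | k'.+1 =>
      let x := dcgd_iter gamma alpha xm gf C x0 k' om in
      x - gamma *: (n%:R^-1 *:
            \sum_(i < n) C k' i om (alpha i *: gf i (Tmap (alpha i) (xm i) x)))
  end.

(* Main.v *)
(** Write xs for the minimizer, h_i = f_i o T_i, g_i for its gradient and c = gamma / n.

    Deterministically, cocoercivity bounds |g_i(x) - g_i(xs)|^2 by 2 alpha_i^2 L_i times the
    Bregman divergence of h_i, and the descent lemma for the sum bounds |sum_i g_i(x)|^2 by
    the same divergences, so for gamma in the admissible range
      |x - c sum_i g_i(x) - xs|^2 + c^2 sum_i w_i |g_i(x)|^2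
        <= (1 - gamma mu_alpha) |x - xs|^2 + 2 c^2 sum_i w_i |g_i(xs)|^2.
    Strong convexity already provides subgradient inequalities, and summing them along a
    subdivided segment replaces integration of the gradient.

    The left-hand side dominates the expected squared error after one step: the compressors
    are applied one worker at a time, and the noise of each is centered, of variance at most
    w_i |g_i(x)|^2, and independent of everything before it.  For the latter, the past is
    measurable with respect to the sigma-algebra generated by all the variables but the
    current one, which is independent of it by the pi-lambda theorem, and Tonelli's theorem
    integrates the fresh variable first.  The contraction then iterates geometrically. *)

Require Import Defs.
From HB Require Import structures.
From mathcomp Require Import all_boot all_order all_algebra.
From mathcomp Require Import all_classical all_reals all_analysis.
From mathcomp Require Import measurable_realfun ring lra.

Set Implicit Arguments.
Unset Strict Implicit.
Unset Printing Implicit Defensive.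

Import Order.TTheory GRing.Theory Num.Theory.
Import numFieldNormedType.Exports.
Local Open Scope classical_set_scope.
Local Open Scope ring_scope.

(** * Smooth strongly convex functions *)

Section Euclidean.
Context {R : realType} {d : nat}.
Implicit Types (x y z : 'rV[R]_d) (a : R).

Lemma dotpC x y : dotp x y = dotp y x.
Proof. by apply: eq_bigr => j _; rewrite mulrC. Qed.

Lemma dotpDl x y z : dotp (x + y) z = dotp x z + dotp y z.
Proof. by rewrite -big_split; apply: eq_bigr => j _; rewrite mxE mulrDl. Qed.

Lemma dotpZl a x y : dotp (a *: x) y = a * dotp x y.
Proof. by rewrite /dotp mulr_sumr; apply: eq_bigr => j _; rewrite mxE mulrA. Qed.

Lemma dotpNl x y : dotp (- x) y = - dotp x y.
Proof. by rewrite -scaleN1r dotpZl mulN1r. Qed.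

Lemma dotpDr x y z : dotp z (x + y) = dotp z x + dotp z y.
Proof. by rewrite dotpC dotpDl !(dotpC z). Qed.

Lemma dotpZr a x y : dotp y (a *: x) = a * dotp y x.
Proof. by rewrite dotpC dotpZl (dotpC y). Qed.

Lemma dotpNr x y : dotp y (- x) = - dotp y x.
Proof. by rewrite dotpC dotpNl (dotpC y). Qed.

Definition dotpE := (dotpDl, dotpDr, dotpNl, dotpNr, dotpZl, dotpZr).

Lemma dotp0l x : dotp 0 x = 0.
Proof. by rewrite /dotp big1 // => j _; rewrite mxE mul0r. Qed.

Lemma dotp_suml (I : Type) (s : seq I) (u : I -> 'rV[R]_d) x :
  dotp (\sum_(i <- s) u i) x = \sum_(i <- s) dotp (u i) x.
Proof.
elim: s => [|i s IH]; last by rewrite !big_cons dotpDl IH.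
by rewrite !big_nil dotp0l.
Qed.

Lemma sqnorm_ge0 x : 0 <= sqnorm x.
Proof. by apply: sumr_ge0 => j _; rewrite -expr2 sqr_ge0. Qed.

Lemma sqnorm_eq0 x : sqnorm x = 0 -> x = 0.
Proof.
move=> x0; apply/rowP => j; rewrite mxE.
move/eqP: x0; rewrite psumr_eq0; last by move=> i _; rewrite -expr2 sqr_ge0.
by move/allP/(_ j (mem_index_enum j)); rewrite -expr2 sqrf_eq0 => /eqP.
Qed.

Lemma sqnormZ a x : sqnorm (a *: x) = a ^+ 2 * sqnorm x.
Proof. by rewrite /sqnorm !dotpE mulrA expr2. Qed.

Lemma sqnormN x : sqnorm (- x) = sqnorm x.
Proof. by rewrite /sqnorm !dotpE opprK. Qed.

Lemma sqnormD x y : sqnorm (x + y) = sqnorm x + 2 * dotp x y + sqnorm y.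
Proof. by rewrite /sqnorm !dotpE (dotpC y x); ring. Qed.

Lemma sqnormB x y : sqnorm (x - y) = sqnorm x - 2 * dotp x y + sqnorm y.
Proof. by rewrite /sqnorm !dotpE (dotpC y x); ring. Qed.

Lemma sqnormBC x y : sqnorm (x - y) = sqnorm (y - x).
Proof. by rewrite !sqnormB (dotpC y); ring. Qed.

Lemma sqnormD_le x y : sqnorm (x + y) <= 2 * sqnorm x + 2 * sqnorm y.
Proof. have := sqnorm_ge0 (x - y); rewrite sqnormB sqnormD; lra. Qed.

Lemma enorm_ge0 x : 0 <= enorm x. Proof. exact: sqrtr_ge0. Qed.

Lemma enorm_sqr x : enorm x ^+ 2 = sqnorm x.
Proof. by rewrite sqr_sqrtr ?sqnorm_ge0. Qed.

Lemma enormBC x y : enorm (x - y) = enorm (y - x).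
Proof. by rewrite /enorm sqnormBC. Qed.

Lemma enormZ a x : 0 <= a -> enorm (a *: x) = a * enorm x.
Proof. by move=> a0; rewrite /enorm sqnormZ sqrtrM ?sqr_ge0 // sqrtr_sqr ger0_norm. Qed.

Lemma coord_le_enorm x j : `|x 0 j| <= enorm x.
Proof.
rewrite -sqrtr_sqr ler_wsqrtr // /sqnorm /dotp (bigD1 j) //= expr2 lerDl.
by apply: sumr_ge0 => i _; rewrite -expr2 sqr_ge0.
Qed.

(** Cauchy-Schwarz: for nonzero [y], expand the squared norm of [|y|^2 x - <x, y> y], which is
    nonnegative, and divide by [|y|^2]. *)
Lemma dotp_le_enorm x y : dotp x y <= enorm x * enorm y.
Proof.
have [y0|y0] := eqVneq (sqnorm y) 0.
  by rewrite dotpC [y in dotp y _]sqnorm_eq0 // dotp0l mulr_ge0 ?enorm_ge0.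
have y_gt0 : 0 < sqnorm y by rewrite lt0r y0 sqnorm_ge0.
have : 0 <= sqnorm (sqnorm y *: x - dotp x y *: y) by exact: sqnorm_ge0.
rewrite sqnormB !sqnormZ !dotpE => h.
apply: le_trans (ler_norm _) _; rewrite -ler_sqr ?nnegrE ?mulr_ge0 ?enorm_ge0 //.
rewrite real_normK ?num_real // exprMn !enorm_sqr -(ler_pM2l y_gt0); nra.
Qed.

End Euclidean.

(** * Descent lemma and cocoercivity of the gradient *)

Section SmoothConvex.
Context {R : realType} {d : nat}.
Variables (f : 'rV[R]_d -> R) (gf : 'rV[R]_d -> 'rV[R]_d) (L mu : R).
Hypotheses (smf : smooth L gf) (mu_gt0 : 0 < mu) (scf : strongly_convex mu f gf).

Lemma smooth_dotp x y : dotp (gf x - gf y) (x - y) <= L * sqnorm (x - y).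
Proof.
apply: le_trans (dotp_le_enorm _ _) _.
by rewrite -enorm_sqr expr2 mulrA ler_wpM2r ?enorm_ge0.
Qed.

(** Strong convexity between [e] and [0], added in both orders, gives
    [mu |e|^2 <= <gf e - gf 0, e>], and [smooth_dotp] bounds this by [L |e|^2]. Positive dimension
    supplies the nonzero vector [e]. *)
Lemma strongly_convex_le_smooth : (0 < d)%N -> mu <= L.
Proof.
case: d f gf smf scf smooth_dotp => // d' f' g' sm sc smd _.
pose e : 'rV[R]_d'.+1 := delta_mx 0 ord0.
have e0 : 0 < sqnorm (e - 0).
  rewrite lt0r sqnorm_ge0 andbT; apply/eqP => /sqnorm_eq0/rowP/(_ ord0).
  by rewrite !mxE /=; lra.
have := smd e 0; have := sc e 0; have := sc 0 e; rewrite -!(sqnormBC e).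
rewrite -(opprB e 0) !dotpE => h1 h2 h3.
by rewrite -(ler_pM2r e0); lra.
Qed.

Lemma subgradient_le x y : f y + dotp (gf y) (x - y) <= f x.
Proof.
apply: le_trans (scf x y); by rewrite lerDl mulr_ge0 ?sqnorm_ge0 // divr_ge0 // ltW.
Qed.

(* Bisecting the segment turns the constant c into 1/4 + c/2, whose fixed point is 1/2. *)
Lemma smooth_upper_bisect (m : nat) x v :
  f (x + v) <= f x + dotp (gf x) v + (2^-1 + 2^-1 ^+ m.+1) * (L * sqnorm v).
Proof.
elim: m x v => [|m IH] x v.
  have := subgradient_le x (x + v); have := smooth_dotp (x + v) x.
  rewrite -(opprB (x + v) x) (addrC x v) addrK !dotpE; lra.
have xvE : x + 2^-1 *: v + 2^-1 *: v = x + v.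
  by rewrite -addrA -scalerDl [_ + 2^-1](_ : _ = 1) ?scale1r //; field.
have := smooth_dotp (x + 2^-1 *: v) x; have := IH x (2^-1 *: v).
have := IH (x + 2^-1 *: v) (2^-1 *: v).
rewrite xvE (addrC x (_ *: v)) addrK !sqnormZ !dotpE (exprS _ m.+1).
move: (2^-1 ^+ m.+1) (f (x + v)) (f (x + _)) => q a b.
move: (sqnorm v) (dotp _ v) (dotp _ v) => s p r.
lra.
Qed.

(** The descent lemma: as the number of bisections grows, the excess over the constant 1/2 tends to
    0. *)
Lemma smooth_upper x v :
  f (x + v) <= f x + dotp (gf x) v + L / 2 * sqnorm v.
Proof.
apply/ler_addgt0Pr => e e0; set c := L * sqnorm v.
(* With this [m], [|c| < e (m+1) <= e 2^(m+1)], so the excess left by the bisection is at most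
   [e]. *)
have [m mP] : exists m : nat, `|c| / e < m.+1%:R.
  by exists (Num.truncn (`|c| / e)); rewrite truncnS_gt.
apply: le_trans (smooth_upper_bisect m x v) _; rewrite -/c.
have cE : 2^-1 ^+ m.+1 * c <= e.
  have: m.+1%:R <= 2 ^+ m.+1 :> R by rewrite -natrX ler_nat ltnW // ltn_expl.
  move: mP; rewrite ltr_pdivrMr // exprVn => mP h.
  rewrite mulrC ler_pdivrMr ?exprn_gt0 //.
  apply: le_trans (ler_norm c) _; apply: le_trans (ltW mP) _.
  by rewrite mulrC ler_wpM2l // ltW.
move: cE; rewrite /c; lra.
Qed.

(** At the point [x - L^-1 *: D], the subgradient inequality at [y] bounds [f] from below and the
    descent lemma from [x] bounds it from above; comparing the two leaves [|D|^2 / (2 L)]. *)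
Lemma cocoercive x y : 0 < L ->
  sqnorm (gf x - gf y) <= 2 * L * (f x - f y - dotp (gf y) (x - y)).
Proof.
move=> L0; set D := gf x - gf y.
have DE : dotp (gf x) D = dotp (gf y) D + sqnorm D.
  by rewrite /sqnorm {3}/D dotpDl dotpNl addrC subrK.
clearbody D; have := smooth_upper x (- (L^-1 *: D)); have := subgradient_le (x - L^-1 *: D) y.
rewrite !dotpE sqnormN sqnormZ => h1 h2.
have LE : L / 2 * (L^-1 ^+ 2 * sqnorm D) = L^-1 * sqnorm D / 2 by field; lra.
rewrite -ler_pdivrMl ?mulr_gt0 // invfM -mulrA.
move: h1 h2; rewrite LE DE mulrDr; lra.
Qed.

End SmoothConvex.

Lemma sumr_ord_gt0 (R : numDomainType) (n : nat) (F : 'I_n -> R) :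
  (0 < n)%N -> (forall i, 0 < F i) -> 0 < \sum_(i < n) F i.
Proof.
case: n F => // n F _ F0.
by rewrite big_ord_recl ltr_pwDl ?sumr_ge0 // => i _; exact: ltW.
Qed.

(** * Deterministic contraction for a sum of functions *)

Section Average.
Context {R : realType} {d n : nat}.
Variables (h : 'I_n -> 'rV[R]_d -> R) (g : 'I_n -> 'rV[R]_d -> 'rV[R]_d).
Variables (l m w : 'I_n -> R) (xs : 'rV[R]_d) (M : R).
Hypotheses (n_gt0 : (0 < n)%N) (l_gt0 : forall i, 0 < l i) (m_gt0 : forall i, 0 < m i).
Hypotheses (smh : forall i, smooth (l i) (g i)).
Hypotheses (sch : forall i, strongly_convex (m i) (h i) (g i)).
Hypothesis (xs_min : forall y, \sum_(i < n) h i xs <= \sum_(i < n) h i y).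

Let suml_gt0 : 0 < \sum_(i < n) l i. Proof. exact: sumr_ord_gt0. Qed.

(** The minimal value is at most the value after a gradient step of length [1 / lam] from [x], where
    [lam] is the sum of the [l i]. By the descent lemma this step lowers the sum by at least
    [|G|^2 / (2 lam)]. *)
Lemma sqnorm_sum_gradient x :
  sqnorm (\sum_(i < n) g i x)
  <= 2 * (\sum_(i < n) l i) * (\sum_(i < n) h i x - \sum_(i < n) h i xs).
Proof.
set G := \sum_(i < n) g i x; set lam := \sum_(i < n) l i.
have := xs_min (x - lam^-1 *: G).
have : \sum_(i < n) h i (x - lam^-1 *: G) <=
    \sum_(i < n) (h i x + dotp (g i x) (- (lam^-1 *: G))
                  + l i / 2 * sqnorm (- (lam^-1 *: G))).
  by apply: ler_sum => i _; apply: smooth_upper (smh i) (m_gt0 i) (sch i) _ _.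
rewrite !big_split /= -dotp_suml -mulr_suml -mulr_suml -/G -/lam.
rewrite sqnormN sqnormZ !dotpE -/(sqnorm G) => h1 h2.
have LE : lam / 2 * (lam^-1 ^+ 2 * sqnorm G) = lam^-1 * sqnorm G / 2.
  by field; rewrite gt_eqF.
rewrite -ler_pdivrMl ?mulr_gt0 // invfM -mulrA.
move: h1 h2; rewrite LE; lra.
Qed.

(** First-order optimality: at [x = xs] the right-hand side of the preceding bound vanishes. *)
Lemma sum_gradient_min : \sum_(i < n) g i xs = 0.
Proof.
apply: sqnorm_eq0; apply/eqP; rewrite eq_le sqnorm_ge0 andbT.
by apply: le_trans (sqnorm_sum_gradient xs) _; rewrite subrr mulr0.
Qed.

Lemma gradient_step (c : R) x :
  0 < c -> (forall i, 0 <= w i) -> (forall i, w i * l i <= M) ->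
  c * (\sum_(i < n) l i + 2 * M) <= 1 ->
  sqnorm (x - c *: (\sum_(i < n) g i x) - xs)
    + c ^+ 2 * \sum_(i < n) w i * sqnorm (g i x)
  <= (1 - c * \sum_(i < n) m i) * sqnorm (x - xs)
     + 2 * c ^+ 2 * \sum_(i < n) w i * sqnorm (g i xs).
Proof.
move=> c0 w0 wlM cM.
have [gG gm] := (sqnorm_sum_gradient x, sum_gradient_min).
(* The Bregman divergence of [h i] between [x] and [xs]. In the sum the linear terms cancel, since
   the gradients at [xs] add up to 0. *)
pose D i := h i x - h i xs - dotp (g i xs) (x - xs).
have D0 i : 0 <= D i.
  by have := subgradient_le (m_gt0 i) (sch i) x xs; rewrite /D; lra.
have DE : \sum_(i < n) D i = \sum_(i < n) h i x - \sum_(i < n) h i xs.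
  by rewrite !sumrB -dotp_suml gm dotp0l subr0.
(* Splitting [g i x] around [g i xs] costs a factor 2 and cocoercivity a factor [2 l i]; with
   [w i * l i <= M] this makes [4 M]. *)
have wg : \sum_(i < n) w i * sqnorm (g i x) <=
    4 * M * \sum_(i < n) D i + 2 * \sum_(i < n) w i * sqnorm (g i xs).
  rewrite !mulr_sumr -big_split /=; apply: ler_sum => i _.
  have := sqnormD_le (g i x - g i xs) (g i xs); rewrite subrK => h1.
  have := cocoercive (smh i) (m_gt0 i) (sch i) x xs (l_gt0 i); rewrite -/(D i) => h2.
  have h3 := ler_wpM2r (D0 i) (wlM i).
  apply: le_trans (ler_wpM2l (w0 i) h1) _.
  have := ler_wpM2l (w0 i) h2; lra.
have gx : \sum_(i < n) D i + (\sum_(i < n) m i) / 2 * sqnorm (x - xs) <=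
    dotp (\sum_(i < n) g i x) (x - xs).
  rewrite DE -sumrB dotp_suml mulr_suml mulr_suml -big_split /=.
  apply: ler_sum => i _; have := sch i xs x.
  by rewrite -(sqnormBC x) -(opprB x) dotpNr; lra.
have S0 : 0 <= \sum_(i < n) D i by exact: sumr_ge0.
rewrite -DE in gG; move: gG wg gx cM S0.
rewrite (addrAC x) (sqnormB (x - xs)) sqnormZ !dotpZr (dotpC (x - xs)).
move: (\sum_(i < n) D i) (sqnorm (\sum_(i < n) g i x)) (dotp _ _) (\sum_(i < n) l i).
move: (\sum_(i < n) w i * sqnorm (g i x)) (\sum_(i < n) w i * sqnorm (g i xs)).
move: (sqnorm _) (\sum_(i < n) m i) => r mm W Ws S G2 p lam gG wg gx cM S0.
have c20 : 0 <= c ^+ 2 by rewrite sqr_ge0.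
have := ler_wpM2l c20 gG; have := ler_wpM2l c20 wg.
have := ler_wpM2l (ltW c0) gx.
(* Altogether the divergences carry the coefficient [-2 c + 2 c^2 lam + 4 c^2 M], which is
   nonpositive exactly under the bound on [c]. *)
have : c * S * (c * (lam + 2 * M)) <= c * S by rewrite ler_piMr // mulr_ge0 // ltW.
lra.
Qed.

End Average.

(** * Measurability and independence *)

Section VectorMeasurability.
Context {R : realType} {d : nat} {dT : measure_display} {T : measurableType dT}.

Definition measurable_vec (X : T -> 'rV[R]_d) :=
  forall j : 'I_d, measurable_fun setT (fun t => X t 0 j).

Definition tuple_of_rv (x : 'rV[R]_d) : d.-tuple R := [tuple x 0 j | j < d].

Lemma tuple_of_rvK : cancel tuple_of_rv (@rv_of_tuple R d).
Proof. by move=> x; apply/rowP => j; rewrite mxE tnth_mktuple. Qed.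

Lemma measurable_tuple_of_rv (X : T -> 'rV[R]_d) :
  measurable_vec X -> measurable_fun setT (tuple_of_rv \o X).
Proof.
move=> mX; apply/measurable_fun_tnthP => j.
by rewrite (_ : _ \o _ = fun t => X t 0 j) //; apply/funext => t /=; rewrite tnth_mktuple.
Qed.

Lemma measurable_vec_cst x : measurable_vec (fun=> x).
Proof. by move=> j. Qed.

Lemma measurable_vecD X Y : measurable_vec X -> measurable_vec Y ->
  measurable_vec (fun t => X t + Y t).
Proof.
move=> mX mY j; under eq_fun do rewrite mxE.
exact: measurable_funD.
Qed.

Lemma measurable_vecZ a X : measurable_vec X -> measurable_vec (fun t => a *: X t).
Proof.
move=> mX j; under eq_fun do rewrite mxE.
exact: measurable_funM.
Qed.

Lemma measurable_vecN X : measurable_vec X -> measurable_vec (fun t => - X t).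
Proof.
by move=> mX j; under eq_fun do rewrite mxE; exact: measurable_funN.
Qed.

Lemma measurable_vecB X Y : measurable_vec X -> measurable_vec Y ->
  measurable_vec (fun t => X t - Y t).
Proof. by move=> mX mY; apply: measurable_vecD => //; exact: measurable_vecN. Qed.

Lemma measurable_vec_sum (I : Type) (s : seq I) (X : I -> T -> 'rV[R]_d) :
  (forall i, measurable_vec (X i)) -> measurable_vec (fun t => \sum_(i <- s) X i t).
Proof.
move=> mX j; under eq_fun do rewrite summxE.
by apply: measurable_sum => i; exact: mX.
Qed.

Lemma measurable_dotp X Y : measurable_vec X -> measurable_vec Y ->
  measurable_fun setT (fun t => dotp (X t) (Y t)).
Proof.
by move=> mX mY; apply: measurable_sum => j; exact: measurable_funM.
Qed.

Lemma measurable_sqnorm X : measurable_vec X ->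
  measurable_fun setT (fun t => sqnorm (X t)).
Proof. by move=> mX; exact: measurable_dotp. Qed.

Lemma rat_vec_dense (x : 'rV[R]_d) (r : R) : 0 < r ->
  exists q : 'rV[rat]_d, sqnorm (x - map_mx ratr q) < r ^+ 2.
Proof.
(* Dividing by [d.+1] covers [d = 0] and makes the final bound [d r^2 / (d+1)^2 < r^2] strict. *)
move=> r0; have e0 : 0 < r / d.+1%:R by rewrite divr_gt0.
have qP j : exists q : rat, `|x 0 j - ratr q| < r / d.+1%:R.
  have [|q] := @rat_in_itvoo R (x 0 j) (x 0 j + r / d.+1%:R); first by rewrite ltrDl.
  rewrite in_itv /= => /andP[q1 q2]; exists q; rewrite ltr_distlC q2 andbT.
  by rewrite (lt_trans _ q1) // ltrBlDr ltrDl.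
have [q Hq] := choice qP; exists (\row_j q j).
have : sqnorm (x - map_mx ratr (\row_j q j)) <= \sum_(j < d) (r / d.+1%:R) ^+ 2.
  apply: ler_sum => j _; rewrite -expr2 !mxE -[leLHS]real_normK ?num_real //.
  by rewrite ler_sqr ?nnegrE ?normr_ge0 ?(ltW e0) // ltW.
move=> /le_lt_trans; apply.
rewrite sumr_const card_ord expr_div_n -[ltLHS]mulr_natl mulrCA gtr_pMr ?exprn_gt0 //.
rewrite ltr_pdivrMr ?exprn_gt0 // mul1r -natrX ltr_nat.
by rewrite -mulnn leq_pmull.
Qed.

(* A superlevel set of a Lipschitz function is a countable union of balls with rational data. *)
Lemma measurable_lipschitz (h : 'rV[R]_d -> R) (L : R) (X : T -> 'rV[R]_d) :
  (forall x y, `|h x - h y| <= L * enorm (x - y)) -> measurable_vec X ->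
  measurable_fun setT (h \o X).
Proof.
move=> hL mX.
wlog L0 : L hL / 0 <= L.
  move=> /(_ `|L|); apply => // x y; apply: le_trans (hL x y) _.
  by rewrite ler_wpM2r ?enorm_ge0 ?ler_norm.
apply: (measurability _ (RGenOInfty.measurableE R)) => _ [_ [a ->]] <-; rewrite setTI.
pose U (p : 'rV[rat]_d * nat) := let q := map_mx ratr p.1 in let r := p.2.+1%:R^-1 : R in
  if a < h q - L * r then [set t | sqnorm (X t - q) < r ^+ 2] else set0.
have -> : (h \o X) @^-1` `]a, +oo[ = \bigcup_p U p.
  apply/seteqP; split => [t|t [[q m] _]]; rewrite /preimage /= in_itv /= andbT; last first.
    rewrite /U /=; case: ifPn => // aq /= tq; apply: lt_le_trans aq _.
    have /ler_normlP[_] := hL (map_mx ratr q) (X t); rewrite lerBlDr => h1.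
    rewrite lerBlDr addrC; apply: le_trans h1 _; rewrite lerD2r enormBC ler_wpM2l //.
    by rewrite -ler_sqr ?nnegrE ?enorm_ge0 // enorm_sqr ltW.
  move=> aX.
  (* The radius is paid for twice, hence the factor 2: once for moving from [X t] to [q], once for
     the margin that [U] demands. *)
  pose m := Num.truncn (2 * L / (h (X t) - a)).
  have mP : 2 * L * m.+1%:R^-1 < h (X t) - a.
    rewrite ltr_pdivrMr // [ltRHS]mulrC -ltr_pdivrMr ?subr_gt0 //.
    by rewrite truncnS_gt.
  have [|q qP] := @rat_vec_dense (X t) (m.+1%:R^-1); first by rewrite invr_gt0.
  exists (q, m) => //; rewrite /U /= ifT //.
  have /ler_normlP[_] := hL (X t) (map_mx ratr q).
  have : L * enorm (X t - map_mx ratr q) <= L * m.+1%:R^-1.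
    by rewrite ler_wpM2l // -ler_sqr ?nnegrE ?enorm_ge0 ?invr_ge0 // enorm_sqr ltW.
  move: mP; rewrite /=; move: (_^-1) (h (X t)) (enorm _) => r u e.
  lra.
apply: countable_bigcupT_measurable => [|p]; first exact: countableP.
rewrite /U /=; case: ifP => // _.
rewrite -[X in measurable X]setTI.
have mf : measurable_fun setT (fun t => sqnorm (X t - map_mx ratr p.1)).
  by apply: measurable_sqnorm; apply: measurable_vecB => //; exact: measurable_vec_cst.
have := mf measurableT _ (measurable_itv `]-oo, (p.2.+1%:R^-1 ^+ 2)[).
by congr measurable; apply/seteqP; split => t /=; rewrite in_itv.
Qed.

(** Each coordinate inherits the Lipschitz constant of [g]. *)
Lemma measurable_vec_smooth (g : 'rV[R]_d -> 'rV[R]_d) (L : R) (X : T -> 'rV[R]_d) :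
  smooth L g -> measurable_vec X -> measurable_vec (fun t => g (X t)).
Proof.
move=> gL mX j.
apply: (@measurable_lipschitz (fun x => g x 0 j) L) => // x y.
apply: le_trans (gL x y); have := coord_le_enorm (g x - g y) j.
by rewrite !mxE.
Qed.

End VectorMeasurability.

(** * Independence of one variable from all the others *)

Section Independence.
Context {R : realType} {d0 : measure_display} {Omega : measurableType d0}.
Context (P : probability Omega R).

Section Rest.
Context {I : eqType} {dS : measure_display} {S : measurableType dS}.
Variables (X : I -> Omega -> S) (j0 : I).
Hypothesis mX : forall i, measurable_fun setT (X i).

(** A pi-system: the sigma-algebra it generates is that of all variables other than [X j0]. *)
Definition rest_cylinders : set (set Omega) :=
  [set A | exists J (B : I -> set S), [/\ uniq J, j0 \notin J,
     forall j, measurable (B j) & A = \big[setI/setT]_(j <- J) (X j @^-1` B j)]].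

Lemma cylinderE (J : seq I) (B : I -> set S) :
  \big[setI/setT]_(j <- J) (X j @^-1` B j) = [set om | forall j, j \in J -> B j (X j om)].
Proof.
elim: J => [|i J IH]; first by rewrite big_nil; apply/seteqP; split.
rewrite big_cons IH; apply/seteqP; split => om /=.
  by move=> [hi hJ] j; rewrite inE => /orP[/eqP->|/hJ].
by move=> h; split => [|j jJ]; apply: h; rewrite inE ?eqxx ?jJ ?orbT.
Qed.

Lemma rest_cylinders_setI : setI_closed rest_cylinders.
Proof.
move=> _ _ [J1 [B1 [u1 n1 m1 ->]]] [J2 [B2 [u2 n2 m2 ->]]].
(* The index lists may overlap, so they are merged without repetition and each family is extended by
   [setT] outside its own list. *)
exists (undup (J1 ++ J2)),
  (fun j => (if j \in J1 then B1 j else setT) `&` (if j \in J2 then B2 j else setT)).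
split; first exact: undup_uniq.
- by rewrite mem_undup mem_cat negb_or n1.
- by move=> j; apply: measurableI; case: ifP.
rewrite !cylinderE; apply/seteqP; split => om /=.
  by move=> [h1 h2] j _; split; case: ifP => // ?; [exact: h1|exact: h2].
move=> h; split => j jJ.
  by have [] := h j; rewrite ?mem_undup ?mem_cat ?jJ.
by have [] := h j; rewrite ?mem_undup ?mem_cat ?jJ ?orbT.
Qed.

Lemma measurable_preimageT {d1 d2} {T1 : measurableType d1} {T2 : measurableType d2}
  (f : T1 -> T2) (B : set T2) : measurable_fun setT f -> measurable B ->
  measurable (f @^-1` B).
Proof. by move=> mf mB; rewrite -[X in measurable X]setTI; exact: mf. Qed.

Lemma rest_cylinders_measurable : rest_cylinders `<=` measurable.
Proof.
move=> _ [J [B [_ _ mB ->]]]; apply: bigsetI_measurable => j _.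
exact: measurable_preimageT.
Qed.

Lemma rest_measurable (j : I) : j != j0 ->
  measurable_fun [set: g_sigma_algebraType rest_cylinders] (X j).
Proof.
move=> jj0 _ B mB; rewrite setTI; apply: sub_sigma_algebra.
exists [:: j], (fun=> B); split => //; first by rewrite inE eq_sym.
by rewrite big_seq1.
Qed.

(** The events that factorize against [Y] form a lambda-system, and mutual independence puts the
    cylinders in it. *)
Lemma rest_independent (A : set Omega) (B : set S) :
  mutually_independent P X -> <<s rest_cylinders >> A -> measurable B ->
  P (A `&` X j0 @^-1` B) = (P A * P (X j0 @^-1` B))%E.
Proof.
move=> indX GA mB; set Y := X j0 @^-1` B.
have mY : measurable Y by exact: measurable_preimageT.
suff : <<s rest_cylinders >> `<=`
    [set A | measurable A /\ P (A `&` Y) = (P A * P Y)%E] by move=> /(_ _ GA)[].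
apply: lambda_system_subset; [exact: rest_cylinders_setI| | |by []].
- apply/dynkin_lambda_system; split.
  + by split => //; rewrite setTI probability_setT mul1e.
  + move=> {GA}A [mA iA]; split; first exact: measurableC.
    have PY : P Y = (P (A `&` Y) + P (~` A `&` Y))%E.
      rewrite -measureU; first by rewrite -setIUl setUCr setTI.
      - exact: measurableI.
      - by apply: measurableI => //; exact: measurableC.
      - by rewrite setIACA setICr set0I.
    move: PY; rewrite iA probability_setC //.
    rewrite -(fineK (fin_num_measure P A mA)) -(fineK (fin_num_measure P Y mY)).
    have mCY : measurable (~` A `&` Y) by apply: measurableI => //; exact: measurableC.
    rewrite -(fineK (fin_num_measure P _ mCY)).
    by rewrite -!EFinM -EFinD => -[yE]; congr (_%:E); move: yE; lra.
  + move=> F tF mF; have mFk k : measurable (F k) by have [] := mF k.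
    split; first exact: bigcup_measurable.
    rewrite setI_bigcupl !measure_bigcup //; last 2 first.
    * by move=> k _; exact: measurableI.
    * exact: trivIset_setIr.
    rewrite -(fineK (fin_num_measure P Y mY)) muleC -nneseriesZl //.
    apply: eq_eseriesr => k _; have [_ fE] := mF k.
    by apply: etrans fE _; rewrite muleC fineK ?fin_num_measure.
- move=> C GC; split; first exact: rest_cylinders_measurable.
  case: GC => J [B' [uJ jJ mB' ->]].
  (* With [B] placed at [j0], the intersection with [Y] becomes one cylinder over [j0 :: J], to
     which mutual independence applies. *)
  pose B2 j := if j == j0 then B else B' j.
  have BE : \big[setI/setT]_(j <- J) (X j @^-1` B' j) =
            \big[setI/setT]_(j <- J) (X j @^-1` B2 j).
    apply: eq_big_seq => j jj; rewrite /B2 ifN //.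
    by apply: contraNneq jJ => <-.
  have := indX (j0 :: J) B2; rewrite /= jJ uJ => /(_ isT).
  rewrite !big_cons /B2 eqxx -/B2 -/Y BE setIC => ->; last first.
    by move=> j _; rewrite /B2; case: ifP.
  rewrite muleC; congr (_ * _)%E; symmetry; apply: indX => // j _.
  by rewrite /B2; case: ifP.
Qed.

End Rest.

(** Independence makes the joint law of [H] and [Y] the product of their laws, so Tonelli's theorem
    integrates [Y] first with the value of [H] frozen. This stands in for conditioning on [H]. *)
Lemma integral_indep_le {d1 d2 : measure_display} {T1 : measurableType d1}
  {T2 : measurableType d2} (H : Omega -> T1) (Y : Omega -> T2)
  (F : T1 * T2 -> \bar R) (G : T1 -> \bar R) :
  measurable_fun setT H -> measurable_fun setT Y ->
  (forall A B, measurable A -> measurable B ->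
     P (H @^-1` A `&` Y @^-1` B) = (P (H @^-1` A) * P (Y @^-1` B))%E) ->
  measurable_fun setT F -> (forall z, (0 <= F z)%E) ->
  measurable_fun setT G ->
  (forall h, (\int[P]_om F (h, Y om) <= G h)%E) ->
  (\int[P]_om F (H om, Y om) <= \int[P]_om G (H om))%E.
Proof.
move=> mH mY ind mF F0 mG FG.
pose Hm : {mfun Omega >-> T1} := mfun_Sub (mem_set mH).
pose Ym : {mfun Omega >-> T2} := mfun_Sub (mem_set mY).
have mHY : measurable_fun setT (fun om => (H om, Y om)) by exact: measurable_fun_pair.
pose HY : {mfun Omega >-> (T1 * T2)%type} := mfun_Sub (mem_set mHY).
have G0 h : (0 <= G h)%E by apply: le_trans (FG h); exact: integral_ge0.
rewrite -[leLHS](@ge0_integral_distribution _ _ _ _ _ P HY F) //.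
rewrite -[leRHS](@ge0_integral_distribution _ _ _ _ _ P Hm G) //.
rewrite (eq_measure_integral (distribution P Hm \x distribution P Ym)%E); last first.
  move=> A mA _; symmetry.
  by apply: (@product_measure_unique _ _ _ _ _ _ _ (distribution P HY)) => // *; exact: ind.
rewrite fubini_tonelli1 //; apply: ge0_le_integral => //.
- by move=> h _; exact: integral_ge0.
- exact: measurable_fun_fubini_tonelli_F.
- move=> h _; apply: le_trans (FG h).
  rewrite /fubini_F (@ge0_integral_distribution _ _ _ _ _ P Ym (fun y => F (h, y))) //.
  exact: measurableT_comp.
Qed.

End Independence.

(** * One compressed step *)

Section CompressionNoise.
Context {R : realType} {d : nat} {d0 : measure_display} {Omega : measurableType d0}.
Variables (P : probability Omega R) (C : Omega -> 'rV[R]_d -> 'rV[R]_d) (w : R).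
Hypotheses (BdC : in_Bd P C w) (mC : forall y, measurable_vec (C^~ y)).
Variable y : 'rV[R]_d.

Let N om := C om y - y.

Let mN : measurable_vec N.
Proof. by apply: measurable_vecB => //; exact: measurable_vec_cst. Qed.

Let integrable_sqnorm_noise : P.-integrable setT (EFin \o (fun om => sqnorm (N om))).
Proof.
apply/integrableP; split; first by apply/measurable_EFinP; exact: measurable_sqnorm.
have [_ h] := BdC y.
apply: (@le_lt_trans _ _ (w * sqnorm y)%:E); last exact: ltry.
apply: le_trans h; rewrite [leLHS](eq_integral (fun om => (sqnorm (N om))%:E)) // => om _ /=.
by rewrite ger0_norm ?sqnorm_ge0.
Qed.

Let integrable_noise j : P.-integrable setT (EFin \o (fun om => N om 0 j)).
Proof.
apply: (@le_integrable _ _ _ _ _ _ _ (EFin \o (fun om => 1 + sqnorm (N om)))) => //.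
- by apply/measurable_EFinP; exact: mN.
- move=> om _ /=; rewrite lee_fin [leRHS]ger0_norm ?addr_ge0 ?sqnorm_ge0 //.
  have := coord_le_enorm (N om) j; rewrite -enorm_sqr.
  (* The square of [t - 1/2] yields [t <= t^2 + 1/4], hence domination by [1 + |N|^2]. *)
  have := sqr_ge0 (enorm (N om) - 2^-1); rewrite sqrrB; lra.
- rewrite (_ : _ \o _ = (EFin \o cst 1) \+ (EFin \o (fun om => sqnorm (N om)))).
    by apply: integrableD => //; exact: finite_measure_integrable_cst.
  by apply/funext.
Qed.

Let integral_noise j : (\int[P]_om (N om 0 j)%:E = 0)%E.
Proof.
have [/(_ j) h _] := BdC y.
have : (\int[P]_om ((N om 0 j)%:E + (y 0 j)%:E) = (y 0 j)%:E)%E.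
  rewrite -[RHS]h; apply: eq_integral => om _.
  by rewrite -EFinD /N !mxE subrK.
rewrite integralD //; last 2 first.
- exact: integrable_noise.
- exact: finite_measure_integrable_cst.
rewrite [X in (_ + X)%E]integral_cst // [X in (_ * X)%E]probability_setT mule1.
by move/(congr1 (fun u => u - (y 0 j)%:E)%E); rewrite addeK // subee.
Qed.

(** When the square is expanded, the cross term integrates to 0 because the noise is centered, and
    the last term is the variance. *)
Lemma integral_sqnorm_noise (z : 'rV[R]_d) (c : R) :
  (\int[P]_om (sqnorm (z - c *: (C om y - y)))%:E
   <= (sqnorm z + c ^+ 2 * (w * sqnorm y))%:E)%E.
Proof.
(* The cross term is split over coordinates, since unbiasedness is known for each coordinate. *)
have E om : (sqnorm (z - c *: (C om y - y)))%:E =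
    (((sqnorm z)%:E + \sum_(j < d) (- (2 * c) * z 0 j)%:E * (N om 0 j)%:E)
     + (c ^+ 2)%:E * (sqnorm (N om))%:E)%E.
  under eq_bigr do rewrite -EFinM.
  rewrite sumEFin -EFinM -!EFinD sqnormB sqnormZ dotpZr -/(N om); congr (_ + _ + _)%:E.
  rewrite /dotp !mulr_sumr -sumrN; apply: eq_bigr => j _; ring.
under eq_integral do rewrite E.
have i1 : P.-integrable setT (fun=> (sqnorm z)%:E) by exact: finite_measure_integrable_cst.
have i2 j : P.-integrable setT (fun om => (- (2 * c) * z 0 j)%:E * (N om 0 j)%:E)%E.
  by apply: integrableZl => //; exact: integrable_noise.
have i4 : P.-integrable setT (fun om => (c ^+ 2)%:E * (sqnorm (N om))%:E)%E.
  by apply: integrableZl => //; exact: integrable_sqnorm_noise.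
have i3 : P.-integrable setT (fun om => \sum_(j < d) (- (2 * c) * z 0 j)%:E * (N om 0 j)%:E)%E.
  by apply: integrable_sum => // j _.
rewrite integralD //; last exact: integrableD.
rewrite integralD // integral_sum // big1 => [|j _]; last first.
  by rewrite integralZl ?integral_noise ?mule0 //; exact: integrable_noise.
rewrite adde0 integral_cst // [X in (_ * X)%E]probability_setT mule1 integralZl //.
have [_ h] := BdC y.
rewrite EFinD leeD2l // EFinM; apply: lee_wpmul2l h.
by rewrite lee_fin sqr_ge0.
Qed.

End CompressionNoise.

(** * Adding the compression noise one worker at a time *)

Section CompressedStep.
Context {R : realType} {d n : nat}.
Context {d0 : measure_display} {Omega : measurableType d0} {P : probability Omega R}.
Context {dS : measure_display} {S : measurableType dS}.
Variables (Q : 'I_n -> S -> 'rV[R]_d -> 'rV[R]_d) (w l : 'I_n -> R).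
Variables (g : 'I_n -> 'rV[R]_d -> 'rV[R]_d) (c : R) (xs : 'rV[R]_d).
Hypothesis mQ : forall i (j : 'I_d),
  measurable_fun setT (fun p : S * d.-tuple R => Q i p.1 (rv_of_tuple p.2) 0 j).
Hypothesis smg : forall i, smooth (l i) (g i).

Lemma measurable_compressor {dT} {T : measurableType dT} i (y : T -> S) (X : T -> 'rV[R]_d) :
  measurable_fun setT y -> measurable_vec X -> measurable_vec (fun t => Q i (y t) (X t)).
Proof.
move=> my mX j.
have -> : (fun t => Q i (y t) (X t) 0 j) =
    (fun p : S * d.-tuple R => Q i p.1 (rv_of_tuple p.2) 0 j)
      \o (fun t => (y t, tuple_of_rv (X t))).
  by apply/funext => t /=; rewrite tuple_of_rvK.
apply: measurableT_comp (mQ i j) _.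
by apply: measurable_fun_pair => //; exact: measurable_tuple_of_rv.
Qed.

(* The error after one step in which only the workers of s compress their gradient. *)
Definition partial_error (s : seq 'I_n) (y : 'I_n -> S) (x : 'rV[R]_d) : 'rV[R]_d :=
  x - c *: (\sum_(i < n) g i x) - xs - c *: \sum_(i <- s) (Q i (y i) (g i x) - g i x).

Lemma partial_error_cons i s y x :
  partial_error (i :: s) y x = partial_error s y x - c *: (Q i (y i) (g i x) - g i x).
Proof. by rewrite /partial_error big_cons scalerDr opprD addrA addrAC. Qed.

Lemma partial_error_all y x :
  partial_error (index_enum 'I_n) y x = x - c *: (\sum_(i < n) Q i (y i) (g i x)) - xs.
Proof.
by rewrite /partial_error sumrB scalerBr opprB addrA (addrAC _ (- xs)) subrK addrAC.
Qed.

(** Measurability of [y i] is asked only for [i] in [s], and [T] is arbitrary, so that the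
    sigma-algebra omitting the variable of a worker outside [s] is allowed. *)
Lemma measurable_partial_error {dT} {T : measurableType dT} s (y : 'I_n -> T -> S)
    (X : T -> 'rV[R]_d) :
  (forall i, i \in s -> measurable_fun setT (y i)) -> measurable_vec X ->
  measurable_vec (fun t => partial_error s (y^~ t) (X t)).
Proof.
move=> my mX; have mg i : measurable_vec (fun t => g i (X t)).
  exact: measurable_vec_smooth (smg i) mX.
apply: measurable_vecB.
  apply: measurable_vecB; last exact: measurable_vec_cst.
  by apply: measurable_vecB => //; apply: measurable_vecZ; exact: measurable_vec_sum.
apply: measurable_vecZ; elim: s my => [|i s IH] my.
  by under eq_fun do rewrite big_nil; exact: measurable_vec_cst.
under eq_fun do rewrite big_cons.
apply: measurable_vecD; last by apply: IH => j js; apply: my; rewrite inE js orbT.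
apply: measurable_vecB => //; apply: measurable_compressor => //.
by apply: my; rewrite inE eqxx.
Qed.

Variables (Y : 'I_n -> Omega -> S) (X : Omega -> 'rV[R]_d).
Hypothesis w_ge0 : forall i, 0 <= w i.
Hypothesis mY : forall i, measurable_fun setT (Y i).
Hypothesis BdQ : forall i, in_Bd P (fun om => Q i (Y i om)) (w i).
Hypothesis mX : measurable_vec X.

(** What the next worker needs from the past: [X] determines the vector to compress, and the partial
    error receives the noise. *)
Let state s om := (tuple_of_rv (X om), tuple_of_rv (partial_error s (Y^~ om) (X om))).

Hypothesis indY : forall i (s : seq 'I_n), i \notin s ->
  forall A B, measurable A -> measurable B ->
  P (state s @^-1` A `&` Y i @^-1` B) = (P (state s @^-1` A) * P (Y i @^-1` B))%E.

Let mZ s : measurable_vec (fun om => partial_error s (Y^~ om) (X om)).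
Proof. exact: measurable_partial_error. Qed.

Let mg i : measurable_vec (fun om => g i (X om)).
Proof. exact: measurable_vec_smooth (smg i) mX. Qed.

(** Independence allows freezing the state; only [Y i] is then random, and [integral_sqnorm_noise]
    applies with the partial error as [z]. *)
Lemma integral_partial_error_cons i s : i \notin s ->
  (\int[P]_om (sqnorm (partial_error (i :: s) (Y^~ om) (X om)))%:E
   <= \int[P]_om (sqnorm (partial_error s (Y^~ om) (X om))
                  + c ^+ 2 * (w i * sqnorm (g i (X om))))%:E)%E.
Proof.
move=> is_.
pose F (p : (d.-tuple R * d.-tuple R) * S) : \bar R :=
  let gx := g i (rv_of_tuple p.1.1) in
  (sqnorm (rv_of_tuple p.1.2 - c *: (Q i p.2 gx - gx)))%:E.
pose G (h : d.-tuple R * d.-tuple R) : \bar R :=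
  (sqnorm (rv_of_tuple h.2) + c ^+ 2 * (w i * sqnorm (g i (rv_of_tuple h.1))))%:E.
have mrv dT (T : measurableType dT) (t : T -> d.-tuple R) : measurable_fun setT t ->
    measurable_vec (fun p => rv_of_tuple (t p)).
  move=> mt j; under eq_fun do rewrite mxE.
  exact: measurableT_comp (measurable_tnth _) mt.
rewrite (eq_integral (fun om => F (state s om, Y i om))); last first.
  by move=> om _; rewrite /F /= !tuple_of_rvK partial_error_cons.
rewrite [leRHS](eq_integral (fun om => G (state s om))); last first.
  by move=> om _; rewrite /G /= !tuple_of_rvK.
apply: (@integral_indep_le R _ Omega P _ _ _ _ (state s) (Y i) F G).
- by apply: measurable_fun_pair; exact: measurable_tuple_of_rv.
- by [].
- exact: indY.
- apply/measurable_EFinP; apply: measurable_sqnorm; apply: measurable_vecB.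
    by apply: mrv; exact: measurableT_comp.
  have mg1 : measurable_vec (fun p : (d.-tuple R * d.-tuple R) * S => g i (rv_of_tuple p.1.1)).
    by apply: measurable_vec_smooth (smg i) _; apply: mrv; exact: measurableT_comp.
  by apply: measurable_vecZ; apply: measurable_vecB => //; exact: measurable_compressor.
- by move=> z; rewrite lee_fin sqnorm_ge0.
- apply/measurable_EFinP; apply: measurable_funD.
    by apply: measurable_sqnorm; exact: mrv.
  do 2 apply: measurable_funM => //.
  by apply: measurable_sqnorm; apply: measurable_vec_smooth (smg i) _; exact: mrv.
- move=> h; have mC y : measurable_vec (fun om => Q i (Y i om) y).
    by apply: measurable_compressor => //; exact: measurable_vec_cst.
  exact: (integral_sqnorm_noise (BdQ i) mC (g i (rv_of_tuple h.1)) (rv_of_tuple h.2) c).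
Qed.

(** Induction on the workers: as [s] has no repetition, each new worker is outside those already
    treated. *)
Lemma integral_partial_error (s : seq 'I_n) : uniq s ->
  (\int[P]_om (sqnorm (partial_error s (Y^~ om) (X om)))%:E
   <= \int[P]_om (sqnorm (X om - c *: (\sum_(i < n) g i (X om)) - xs)
                  + c ^+ 2 * \sum_(i <- s) w i * sqnorm (g i (X om)))%:E)%E.
Proof.
have mwg i : measurable_fun setT (fun om => c ^+ 2 * (w i * sqnorm (g i (X om)))).
  by do 2 apply: measurable_funM => //; exact: measurable_sqnorm.
have wg0 i om : 0 <= c ^+ 2 * (w i * sqnorm (g i (X om))).
  by rewrite mulr_ge0 ?sqr_ge0 // mulr_ge0 ?sqnorm_ge0.
elim: s => [_|i s IH /= /andP[is_ us]].
  rewrite /partial_error; under eq_integral do rewrite big_nil scaler0 subr0.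
  by under [leRHS]eq_integral do rewrite big_nil mulr0 addr0.
apply: le_trans (integral_partial_error_cons is_) _.
(* The variance term of [i] occurs on both sides; splitting it off leaves the induction
   hypothesis. *)
under eq_integral do rewrite EFinD.
under [leRHS]eq_integral do rewrite big_cons mulrDr addrCA addrC EFinD.
have m0 : measurable_vec (fun om => X om - c *: (\sum_(i < n) g i (X om)) - xs).
  have := mZ [::]; rewrite /partial_error => h j.
  by have := h j; under eq_fun do rewrite big_nil scaler0 subr0.
rewrite !ge0_integralD //; first by rewrite leeD2r // IH.
- move=> om _; rewrite lee_fin addr_ge0 ?sqnorm_ge0 // mulr_ge0 ?sqr_ge0 //.
  by rewrite sumr_ge0 // => j _; rewrite mulr_ge0 ?sqnorm_ge0.
- apply/measurable_EFinP; apply: measurable_funD; first exact: measurable_sqnorm.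
  apply: measurable_funM => //; apply: measurable_sum => j; apply: measurable_funM => //.
  exact: measurable_sqnorm.
- by move=> om _; rewrite lee_fin.
- by apply/measurable_EFinP; exact: mwg.
- by move=> om _; rewrite lee_fin sqnorm_ge0.
- by apply/measurable_EFinP; apply: measurable_sqnorm; exact: mZ.
- by move=> om _; rewrite lee_fin.
- by apply/measurable_EFinP; exact: mwg.
Qed.

End CompressedStep.

(** * Convergence *)

Section Mixture.
Context {R : realType} {d : nat}.
Variables (f : 'rV[R]_d -> R) (gf : 'rV[R]_d -> 'rV[R]_d) (a : R) (xm : 'rV[R]_d).

Let TmapB x y : Tmap a xm x - Tmap a xm y = a *: (x - y).
Proof. by rewrite /Tmap opprD addrACA subrr addr0 scalerBr. Qed.

(** One factor [a] is the outer scaling of the gradient; the other arises because [Tmap] scales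
    distances by [a]. *)
Lemma smooth_mixture L : 0 <= a -> smooth L gf ->
  smooth (a ^+ 2 * L) (fun x => a *: gf (Tmap a xm x)).
Proof.
move=> a0 smf x y; rewrite -scalerBr enormZ //.
have := ler_wpM2l a0 (smf (Tmap a xm x) (Tmap a xm y)).
by rewrite TmapB enormZ //; congr (_ <= _); ring.
Qed.

Lemma strongly_convex_mixture mu : strongly_convex mu f gf ->
  strongly_convex (a ^+ 2 * mu) (f \o Tmap a xm) (fun x => a *: gf (Tmap a xm x)).
Proof.
move=> scf x y; apply: le_trans (scf (Tmap a xm x) (Tmap a xm y)).
by rewrite TmapB sqnormZ !dotpE /= le_eqVlt; apply/orP; left; apply/eqP; field.
Qed.

End Mixture.

Lemma sqnorm_dim0 (R : realType) (d : nat) (x : 'rV[R]_d) : d = 0%N -> sqnorm x = 0.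
Proof. by move=> d0; subst d; rewrite /sqnorm /dotp big_ord0. Qed.

(** * Measurability of the iterates *)

Section Iterates.
Context {R : realType} {d n : nat}.
Variables (gamma : R) (alpha : 'I_n -> R) (xm : 'I_n -> 'rV[R]_d).
Variables (gf : 'I_n -> 'rV[R]_d -> 'rV[R]_d) (L : 'I_n -> R) (x0 : 'rV[R]_d).
Context {dS : measure_display} {S : measurableType dS}.
Variable Q : nat -> 'I_n -> S -> 'rV[R]_d -> 'rV[R]_d.
Hypothesis smf : forall i, smooth (L i) (gf i).
Hypothesis alpha_ge0 : forall i, 0 <= alpha i.
Hypothesis mQ : forall k i (j : 'I_d),
  measurable_fun setT (fun p : S * d.-tuple R => Q k i p.1 (rv_of_tuple p.2) 0 j).

(** Only the variables of steps before [k] enter, so the sigma-algebra on [T] may omit a variable of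
    step [k]. *)
Lemma measurable_dcgd_iter {dT} {T : measurableType dT} (y : nat -> 'I_n -> T -> S) k :
  (forall k' i, (k' < k)%N -> measurable_fun setT (y k' i)) ->
  measurable_vec (dcgd_iter gamma alpha xm gf (fun k i om => Q k i (y k i om)) x0 k).
Proof.
elim: k => [_|k IH my]; first exact: measurable_vec_cst.
have mX := IH (fun k' i lt => my k' i (ltnW lt)).
apply: measurable_vecB => //; do 2 apply: measurable_vecZ.
apply: measurable_vec_sum => i; apply: (measurable_compressor (mQ k)); first exact: my.
exact: (measurable_vec_smooth (smooth_mixture (xm i) (alpha_ge0 i) (smf i)) mX).
Qed.

End Iterates.

Theorem theorem3 (R : realType) (d n : nat)
  (f : 'I_n -> 'rV[R]_d -> R) (gf : 'I_n -> 'rV[R]_d -> 'rV[R]_d)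
  (L mu : 'I_n -> R) (xm : 'I_n -> 'rV[R]_d) (alpha w : 'I_n -> R)
  (xstar x0 : 'rV[R]_d) (gamma : R)
  (d0 : measure_display) (Omega : measurableType d0) (P : probability Omega R)
  (dS : measure_display) (S : measurableType dS)
  (xi : nat -> 'I_n -> Omega -> S)
  (Q : nat -> 'I_n -> S -> 'rV[R]_d -> 'rV[R]_d) :
  (0 < n)%N ->
  (forall i, is_gradient (f i) (gf i)) ->
  (forall i, smooth (L i) (gf i)) ->
  (forall i, 0 < mu i) ->
  (forall i, strongly_convex (mu i) (f i) (gf i)) ->
  (forall i, is_minimizer (f i) (xm i)) ->
  (forall i, 0 < alpha i < 1) ->
  is_minimizer (fun x => n%:R^-1 * \sum_(i < n) f i (Tmap (alpha i) (xm i) x)) xstar ->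
  (forall i, 0 <= w i) ->
  (* the compressors C_i^k = Q k i \o xi k i are random operators *)
  (forall k i, measurable_fun setT (xi k i)) ->
  (forall k i (j : 'I_d),
      measurable_fun setT (fun p : S * d.-tuple R => Q k i p.1 (rv_of_tuple p.2) 0 j)) ->
  (forall k i, in_Bd P (fun om => Q k i (xi k i om)) (w i)) ->
  (* drawn independently across i and k *)
  mutually_independent P (fun ki : nat * 'I_n => xi ki.1 ki.2) ->
  let Lalpha := n%:R^-1 * \sum_(i < n) alpha i ^+ 2 * L i in
  let mualpha := n%:R^-1 * \sum_(i < n) alpha i ^+ 2 * mu i in
  0 < gamma ->
  gamma <= (Lalpha + 2 * (\big[Num.max/0]_(i < n) (L i * alpha i ^+ 2 * w i)) / n%:R)^-1 ->
  forall k : nat,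
    (\int[P]_om
        (sqnorm (dcgd_iter gamma alpha xm gf (fun k i om => Q k i (xi k i om)) x0 k om
                 - xstar))%:E
     <= ((1 - gamma * mualpha) ^+ k * sqnorm (x0 - xstar)
         + 2 * gamma / (mualpha * n%:R ^+ 2)
           * \sum_(i < n) w i * sqnorm (alpha i *: gf i (Tmap (alpha i) (xm i) xstar)))%:E)%E.
Proof.
move=> n0 _ smf mu0 scf _ alpha01 xs_min w0 mxi mQ BdQ ind Lalpha mualpha gamma0 gammaL.
(* In dimension 0 every norm vanishes; the comparison [mu i <= L i] below relies on a nonzero
   vector. *)
have [d_0|dn0] := eqVneq d 0%N.
  move=> k; under eq_integral do rewrite sqnorm_dim0 //.
  rewrite integral_cst // mul0e lee_fin sqnorm_dim0 // mulr0 add0r big1 ?mulr0 // => i _.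
  by rewrite sqnorm_dim0 // mulr0.
have a0 i : 0 < alpha i by have /andP[] := alpha01 i.
have a20 i : 0 < alpha i ^+ 2 by rewrite exprn_gt0.
have nR0 : 0 < n%:R :> R by rewrite ltr0n.
have muL i : mu i <= L i.
  by apply: (strongly_convex_le_smooth (smf i) (scf i)); rewrite lt0n.
pose h i := f i \o Tmap (alpha i) (xm i).
pose g i x := alpha i *: gf i (Tmap (alpha i) (xm i) x).
pose l i := alpha i ^+ 2 * L i; pose m i := alpha i ^+ 2 * mu i.
have m0 i : 0 < m i by exact: mulr_gt0.
have l0 i : 0 < l i by rewrite mulr_gt0 // (lt_le_trans (mu0 i)).
have smg i : smooth (l i) (g i) by apply: smooth_mixture => //; exact: ltW.
have scg i : strongly_convex (m i) (h i) (g i) by exact: strongly_convex_mixture.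
have hmin y : \sum_(i < n) h i xstar <= \sum_(i < n) h i y.
  by have := xs_min y; rewrite ler_pM2l ?invr_gt0.
set M := \big[Num.max/0]_(i < n) _ in gammaL.
(* The maximum starts from the default value 0. *)
have M0 : 0 <= M by exact: bigmax_ge_id.
have wlM i : w i * l i <= M.
  have -> : w i * l i = L i * alpha i ^+ 2 * w i by rewrite /l; ring.
  exact: (le_bigmax _ (fun i => L i * alpha i ^+ 2 * w i)).
(* [c] absorbs the [1/n] of the averages, so the bounds for sums apply; the step-size condition
   becomes [cL]. *)
pose c := gamma / n%:R; have c0 : 0 < c by exact: divr_gt0.
have suml0 : 0 < \sum_(i < n) l i by exact: sumr_ord_gt0.
have summ0 : 0 < \sum_(i < n) m i by exact: sumr_ord_gt0.
have cL : c * (\sum_(i < n) l i + 2 * M) <= 1.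
  have -> : c * (\sum_(i < n) l i + 2 * M) = gamma * (Lalpha + 2 * M / n%:R).
    by rewrite /c /Lalpha -/l; field; rewrite gt_eqF.
  rewrite -ler_pdivlMr ?div1r // ltr_pwDl ?mulr_gt0 ?invr_gt0 //.
  by rewrite divr_ge0 ?mulr_ge0 // ltW.
have cm : c * \sum_(i < n) m i = gamma * mualpha.
  by rewrite /c /mualpha -/m mulrA.
have gm0 : 0 < gamma * mualpha by rewrite -cm mulr_gt0.
(* As [m i <= l i], this follows from [cL]. The sign is needed to multiply the induction hypothesis
   by this factor. *)
have gm1 : 0 <= 1 - gamma * mualpha.
  rewrite subr_ge0 -cm; apply: le_trans cL; rewrite ler_pM2l //.
  apply: (@le_trans _ _ (\sum_(i < n) l i)); last by rewrite lerDl mulr_ge0.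
  by apply: ler_sum => i _; rewrite ler_pM2l.
set W := \sum_(i < n) w i * _; set B := 2 * gamma / _ * W.
have W0 : 0 <= W by apply: sumr_ge0 => i _; rewrite mulr_ge0 ?sqnorm_ge0.
(* [B] is the fixed point of the one-step recursion [u |-> (1 - gamma mualpha) u + 2 c^2 W], so each
   step of the induction reproduces it. *)
have BE : 2 * c ^+ 2 * W = gamma * mualpha * B.
  rewrite /B /c; field; rewrite gt_eqF //=.
  by move: gm0; rewrite pmulr_rgt0 // => /gt_eqF ->.
have B0 : 0 <= B.
  by rewrite -(pmulr_rge0 _ gm0) -BE mulr_ge0 // mulr_ge0 ?sqr_ge0.
elim=> [|k IH].
  rewrite /= integral_cst // [X in (_ * X)%E]probability_setT mule1 lee_fin.
  by rewrite expr0 mul1r lerDl.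
set X := dcgd_iter gamma alpha xm gf _ x0 k in IH.
have mX : measurable_vec X.
  by apply: measurable_dcgd_iter => // i; exact: ltW.
have indY i (s : seq 'I_n) : i \notin s -> forall A B, measurable A -> measurable B ->
    let st om := (tuple_of_rv (X om),
                  tuple_of_rv (partial_error (Q k) g c xstar s ((xi k)^~ om) (X om))) in
    P (st @^-1` A `&` xi k i @^-1` B) = (P (st @^-1` A) * P (xi k i @^-1` B))%E.
  move=> is_ A B' mA mB st.
  (* [rest] leaves out only the draw [xi k i]. The iterate [X] uses earlier steps and the partial
     error only the workers of [s], so the state is measurable for the generated sigma-algebra. *)
  pose rest := rest_cylinders (fun ki : nat * 'I_n => xi ki.1 ki.2) (k, i).
  have mrest k' i' : (k', i') != (k, i) ->
      measurable_fun [set: g_sigma_algebraType rest] (xi k' i').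
    exact: (@rest_measurable _ _ _ _ _ (fun ki : nat * 'I_n => xi ki.1 ki.2) (k, i) (k', i')).
  apply: (@rest_independent _ _ _ P _ _ _ (fun ki : nat * 'I_n => xi ki.1 ki.2) (k, i)) => //.
  have mX' : @measurable_vec R d _ (g_sigma_algebraType rest) X.
    apply: measurable_dcgd_iter => // [i'|k' i' kk']; first exact: ltW.
    by apply: mrest; rewrite xpair_eqE negb_and ltn_eqF.
  have mst : @measurable_fun _ _ (g_sigma_algebraType rest) _ setT st.
    apply: measurable_fun_pair; first exact: measurable_tuple_of_rv.
    apply: measurable_tuple_of_rv; apply: measurable_partial_error => // i' i's.
    apply: mrest; rewrite xpair_eqE eqxx /=.
    by apply: contraNneq is_ => <-.
  by have := mst measurableT A mA; rewrite setTI.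
have := integral_partial_error (mQ k) smg w0 (mxi k) (BdQ k) mX indY (index_enum_uniq 'I_n).
under eq_integral do rewrite partial_error_all.
move=> step.
have XE om : dcgd_iter gamma alpha xm gf (fun k i om => Q k i (xi k i om)) x0 k.+1 om =
    X om - c *: (\sum_(i < n) Q k i (xi k i om) (g i (X om))).
  by rewrite /= -/X scalerA.
under eq_integral do rewrite XE.
apply: le_trans step _.
(* The deterministic contraction is applied pointwise under the integral. *)
apply: (@le_trans _ _ (\int[P]_om ((1 - gamma * mualpha)%:E * (sqnorm (X om - xstar))%:E
     + (2 * c ^+ 2 * W)%:E))%E).
  apply: ge0_le_integral => //.
  - move=> om _; rewrite lee_fin addr_ge0 ?sqnorm_ge0 // mulr_ge0 ?sqr_ge0 //.
    by rewrite sumr_ge0 // => i _; rewrite mulr_ge0 ?sqnorm_ge0.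
  - have mg i : measurable_vec (fun om => g i (X om)).
      exact: measurable_vec_smooth (smg i) mX.
    apply/measurable_EFinP; apply: measurable_funD.
      apply: measurable_sqnorm; apply: measurable_vecB; last exact: measurable_vec_cst.
      by apply: measurable_vecB => //; apply: measurable_vecZ; exact: measurable_vec_sum.
    apply: measurable_funM => //; apply: measurable_sum => i; apply: measurable_funM => //.
    exact: measurable_sqnorm.
  - apply/measurable_EFinP; apply: measurable_funD => //; apply: measurable_funM => //.
    by apply: measurable_sqnorm; apply: measurable_vecB => //; exact: measurable_vec_cst.
  - move=> om _; rewrite -EFinM -EFinD lee_fin -cm.
    exact: (gradient_step (h := h) n0 l0 m0 smg scg hmin).
have msq : measurable_fun setT (fun om => (sqnorm (X om - xstar))%:E).
  by apply/measurable_EFinP; apply: measurable_sqnorm; apply: measurable_vecB => //.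
rewrite ge0_integralD //; last 3 first.
- by move=> om _; rewrite -EFinM lee_fin mulr_ge0 ?sqnorm_ge0.
- exact: measurable_funeM.
- by move=> om _; rewrite lee_fin BE mulr_ge0 // ltW.
rewrite ge0_integralZl_EFin //; last by move=> om _; rewrite lee_fin sqnorm_ge0.
rewrite integral_cst // [X in (_ + _ * X)%E]probability_setT mule1 BE.
apply: le_trans (leeD2r _ (lee_wpmul2l _ IH)) _; first by rewrite lee_fin.
by rewrite -EFinM -EFinD lee_fin exprS le_eqVlt; apply/orP; left; apply/eqP; ring.
Qed.
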